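(* Let $R$ be a commutative ring with identity, let $r_1,\ldots,r_n\in R$, let $$R[\rho_1,\ldots,\rho_n]=R[T_1,\ldots,T_n]/(T_1(T_1-r_1),\ldots,T_n(T_n-r_n)),$$ where $\rho_i$ is the image of $T_i$ in the quotient ring for all $i$, and let $S$ be a finite multisubset of $R$. Let $\mathbf{n}=\{1,2,\ldots,n\}$, and for all $T=\{i_1,\ldots,i_k\}\subseteq\mathbf{n}$ (with $i_1<\cdots<i_k$) let $\rho_T=\prod_{i\in T}\rho_i$ and let $r_T$ denote the multisubset $\{r_{i_1},\ldots,r_{i_k}\}$ of $R$. Then $$\operatorname{Int}(R[\rho_1,\ldots,\rho_n];S)=\bigoplus_{T\subseteq\mathbf{n}}\operatorname{Int}(R;S\cup r_{\mathbf{n}-T})\,\rho_T.$$ In particular, $$\operatorname{Int}(R[\rho_1,\ldots,\rho_n])=\bigoplus_{T\subseteq\mathbf{n}}\operatorname{Int}(R;r_{\mathbf{n}-T})\,\rho_T.$$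
   Context: All rings are commutative with identity. For a ring $A$, $T(A)$ (with a ring as argument) is its total quotient ring, i.e. the localization at all non-zerodivisors, and $\operatorname{Int}(A)=\{f\in T(A)[X]:f(A)\subseteq A\}$. For a ring $B$ and $f\in B[X]$, there is a unique polynomial $\Delta_Yf(X)\in B[X,Y]$ with $f(X+Y)-f(X)=Y\,\Delta_Yf(X)$; for $b\in B$, $\Delta_bf(X)\in B[X]$ denotes the result of substituting $Y=b$. (Thus $\Delta_0f=f'$.) For a ring $A$ and a finite multisubset $S$ of $A$, the set $\operatorname{Int}(A;S)\subseteq\operatorname{Int}(A)$ is defined recursively on $|S|$: $\operatorname{Int}(A;\emptyset)=\operatorname{Int}(A)$, and for $s\in A$, $$\operatorname{Int}(A;S\cup\{s\})=\Big\{f\in\operatorname{Int}(A;S):\ y\,\Delta_{y s\prod_{t\in S-T}t}f(X)\in\operatorname{Int}(A;T)\text{ for all sub-multisets }T\subseteq S\text{ and all }y\in A\Big\},$$ where the operators $\Delta$ act on $T(A)[X]$, elements of $A$ are regarded in $T(A)$, an empty product is $1$, and unions of multisets add multiplicities; this is independent of the order in which the elements of the multiset are adjoined. A multisubset $S$ of $R$ is regarded as a multisubset of $R[\rho_1,\ldots,\rho_n]\supseteq R$. The ring $R[\rho_1,\ldots,\rho_n]$ is free over $R$ with basis $(\rho_T)_{T\subseteq\mathbf{n}}$, and its total quotient ring is identified canonically with $T(R)[\rho_1,\ldots,\rho_n]=\bigoplus_T T(R)\rho_T$, so that $T(R[\rho_1,\ldots,\rho_n])[X]=\bigoplus_T T(R)[X]\rho_T$.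 *)

(* Defs.v *)
From HB Require Import structures.
From mathcomp Require Import all_boot all_order all_algebra.
From mathcomp Require Import ring_quotient generic_quotient finmap multiset.
From mathcomp Require Import boolp ring zify.

Set Implicit Arguments.
Unset Strict Implicit.
Unset Printing Implicit Defensive.

Import GRing.Theory.

Local Open Scope ring_scope.
Local Open Scope quotient_scope.

Module TotalQuotient.
Section Construction.
Variable A : comNzRingType.

Definition pairs := {x : A * A | `[< GRing.lreg x.2 >]}.
HB.instance Definition _ := Choice.on pairs.
Implicit Types x y z : pairs.

Definition num x : A := (val x).1.
Definition den x : A := (val x).2.

Lemma den_reg x : GRing.lreg (den x).
Proof. exact/asboolP/(valP x). Qed.

Definition mk (a b : A) (hb : GRing.lreg b) : pairs :=
  exist _ (a, b) (asboolT (hb : GRing.lreg (a, b).2)).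

Definition equiv x y := num x * den y == num y * den x.

Lemma equiv_refl : reflexive equiv. Proof. by move=> x; apply/eqP. Qed.

Lemma equiv_sym : symmetric equiv.
Proof. by move=> x y; rewrite /equiv eq_sym. Qed.

Lemma equiv_trans : transitive equiv.
Proof.
move=> y x z /eqP xy /eqP yz; apply/eqP/(den_reg (x := y)).
transitivity (num x * den y * den z); first by ring.
by rewrite xy; transitivity (num y * den z * den x); [ring | rewrite yz; ring].
Qed.

Canonical equiv_rel := EquivRel equiv equiv_refl equiv_sym equiv_trans.

Definition type := {eq_quot equiv}.
HB.instance Definition _ : EqQuotient _ equiv type := EqQuotient.on type.
HB.instance Definition _ := Choice.on type.

Definition frac (a b : A) (hb : GRing.lreg b) : type := \pi_type (mk a hb).

Lemma fracP (u : type) : exists a b (hb : GRing.lreg b), u = frac a hb.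
Proof.
elim/quotW: u => -[[a b] h]; exists a, b, (asboolW h).
by congr (\pi_type _); apply: val_inj.
Qed.

Lemma frac_pi x : frac (num x) (@den_reg x) = \pi_type x.
Proof. by congr (\pi_type _); apply: val_inj; rewrite /= -surjective_pairing. Qed.

Lemma eq_frac a b c d (hb : GRing.lreg b) (hd : GRing.lreg d) :
  frac a hb = frac c hd <-> a * d = c * b.
Proof.
rewrite /frac; split=> [/eqmodP/eqP//|e].
by apply/eqmodP/eqP.
Qed.

Definition add_pair x y :=
  mk (num x * den y + num y * den x) (lregM (@den_reg x) (@den_reg y)).
Definition opp_pair x := mk (- num x) (@den_reg x).
Definition mul_pair x y := mk (num x * num y) (lregM (@den_reg x) (@den_reg y)).
(* MathComp requires the inverse of a non-unit to be itself. *)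
Definition inv_pair x :=
  if pselect (GRing.lreg (num x)) is left h then mk (den x) h else x.

Definition zero : type := frac 0 (@lreg1 A).
Definition one : type := frac 1 (@lreg1 A).
Definition add (u v : type) : type := \pi_type (add_pair (repr u) (repr v)).
Definition opp (u : type) : type := \pi_type (opp_pair (repr u)).
Definition mul (u v : type) : type := \pi_type (mul_pair (repr u) (repr v)).
Definition inv (u : type) : type := \pi_type (inv_pair (repr u)).
Definition unit : pred type := fun u => `[< GRing.lreg (num (repr u)) >].

Lemma repr_frac a b (hb : GRing.lreg b) :
  num (repr (frac a hb)) * b = a * den (repr (frac a hb)).
Proof. by apply/(eq_frac _ _ (@den_reg _)); rewrite frac_pi reprK. Qed.

Lemma addE a b c d (hb : GRing.lreg b) (hd : GRing.lreg d) :
  add (frac a hb) (frac c hd) = frac (a * d + c * b) (lregM hb hd).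
Proof.
apply/eq_frac; have := repr_frac c hd; have := repr_frac a hb.
move: (repr _) (repr _) => y x e1 e2.
transitivity (num x * b * (den y * d) + num y * d * (den x * b)); first by ring.
by rewrite e1 e2; ring.
Qed.

Lemma oppE a b (hb : GRing.lreg b) : opp (frac a hb) = frac (- a) hb.
Proof. by apply/eq_frac; rewrite !mulNr repr_frac. Qed.

Lemma mulE a b c d (hb : GRing.lreg b) (hd : GRing.lreg d) :
  mul (frac a hb) (frac c hd) = frac (a * c) (lregM hb hd).
Proof.
apply/eq_frac; have := repr_frac c hd; have := repr_frac a hb.
move: (repr _) (repr _) => y x e1 e2.
transitivity (num x * b * (num y * d)); first by ring.
by rewrite e1 e2; ring.
Qed.

Lemma addA : associative add.
Proof.
move=> u v w; have [a [b [hb ->]]] := fracP u; have [c [d [hd ->]]] := fracP v.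
by have [e [f [hf ->]]] := fracP w; rewrite !addE; apply/eq_frac; ring.
Qed.

Lemma addC : commutative add.
Proof.
move=> u v; have [a [b [hb ->]]] := fracP u; have [c [d [hd ->]]] := fracP v.
by rewrite !addE; apply/eq_frac; ring.
Qed.

Lemma add0 : left_id zero add.
Proof.
move=> u; have [a [b [hb ->]]] := fracP u.
by rewrite !addE; apply/eq_frac; ring.
Qed.

Lemma addN : left_inverse zero opp add.
Proof.
move=> u; have [a [b [hb ->]]] := fracP u.
by rewrite !oppE !addE; apply/eq_frac; ring.
Qed.

HB.instance Definition _ := GRing.isZmodule.Build type addA addC add0 addN.

Lemma mulA : associative mul.
Proof.
move=> u v w; have [a [b [hb ->]]] := fracP u; have [c [d [hd ->]]] := fracP v.
by have [e [f [hf ->]]] := fracP w; rewrite !mulE; apply/eq_frac; ring.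
Qed.

Lemma mulC : commutative mul.
Proof.
move=> u v; have [a [b [hb ->]]] := fracP u; have [c [d [hd ->]]] := fracP v.
by rewrite !mulE; apply/eq_frac; ring.
Qed.

Lemma mul1 : left_id one mul.
Proof.
move=> u; have [a [b [hb ->]]] := fracP u.
by rewrite !mulE; apply/eq_frac; ring.
Qed.

Lemma mulDl : left_distributive mul add.
Proof.
move=> u v w; have [a [b [hb ->]]] := fracP u; have [c [d [hd ->]]] := fracP v.
by have [e [f [hf ->]]] := fracP w; rewrite addE !mulE addE; apply/eq_frac; ring.
Qed.

Lemma one_neq0 : one != zero.
Proof. by apply/eqP => /eq_frac/eqP; rewrite mul1r mul0r oner_eq0. Qed.

HB.instance Definition _ :=
  GRing.Zmodule_isComNzRing.Build type mulA mulC mul1 mulDl one_neq0.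

Lemma mulVx : {in unit, left_inverse one inv mul}.
Proof.
move=> u /asboolP h; rewrite /inv /inv_pair; case: pselect => // h'.
transitivity (mul (frac (den (repr u)) h') (frac (num (repr u)) (@den_reg (repr u)))).
  by rewrite frac_pi reprK.
by rewrite mulE; apply/eq_frac; ring.
Qed.

Lemma unitPl (u v : type) : mul v u = one -> unit u.
Proof.
have [c [d [hd ->]]] := fracP v.
rewrite -[u in mul _ u]reprK -frac_pi mulE => /eq_frac; rewrite mulr1 mul1r => e.
apply/asboolP => x y exy; apply: (lregM hd (@den_reg (repr u))).
by rewrite -e -!mulrA exy.
Qed.

Lemma inv_out : {in predC unit, inv =1 id}.
Proof.
move=> u /asboolPn h; rewrite /inv /inv_pair.
by case: pselect => // _; rewrite reprK.
Qed.

HB.instance Definition _ :=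
  GRing.ComNzRing_hasMulInverse.Build type mulVx unitPl inv_out.

Definition inj (a : A) : type := frac a (@lreg1 A).

Lemma inj_zmod : zmod_morphism inj.
Proof.
move=> a b; rewrite -[RHS]/(add _ (opp _)) oppE addE; apply/eq_frac; ring.
Qed.

Lemma inj_monoid : monoid_morphism inj.
Proof.
by split=> // a b; rewrite -[RHS]/(mul _ _) mulE; apply/eq_frac; ring.
Qed.

HB.instance Definition _ := GRing.isZmodMorphism.Build A type inj inj_zmod.
HB.instance Definition _ := GRing.isMonoidMorphism.Build A type inj inj_monoid.

End Construction.
End TotalQuotient.
HB.export TotalQuotient.

Notation totq := TotalQuotient.type.
Notation totq_inj := (@TotalQuotient.inj _).

Section TotalQuotientTheory.
Variable A : comNzRingType.
Implicit Types a b : A.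

Lemma totq_inj_inj : injective (totq_inj : A -> totq A).
Proof. by move=> a b /TotalQuotient.eq_frac; rewrite !mulr1. Qed.

Lemma totq_inj_unit a : GRing.lreg a -> (totq_inj a : totq A) \is a GRing.unit.
Proof.
move=> ha; apply/unitrP; exists (TotalQuotient.frac 1 ha).
rewrite -[_ * _]/(TotalQuotient.mul _ _) -[X in _ /\ X = _]/(TotalQuotient.mul _ _).
by split; rewrite TotalQuotient.mulE; apply/TotalQuotient.eq_frac; ring.
Qed.

Lemma totq_fracE a b (hb : GRing.lreg b) :
  TotalQuotient.frac a hb = totq_inj a / totq_inj b.
Proof.
apply: (mulIr (totq_inj_unit hb)); rewrite divrK ?totq_inj_unit//.
rewrite -[LHS]/(TotalQuotient.mul _ _) TotalQuotient.mulE.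
by apply/TotalQuotient.eq_frac; ring.
Qed.

Lemma totqP (u : totq A) :
  exists a b, GRing.lreg b /\ u = totq_inj a / totq_inj b.
Proof.
have [a [b [hb ->]]] := TotalQuotient.fracP u.
by exists a, b; split; last exact: totq_fracE.
Qed.

End TotalQuotientTheory.

(* The canonical map T(A) -> T(B) sending a / b to phi a / phi b; it is
   meaningful only when phi preserves non-zerodivisors (see totq_mapE), since
   the inverse of a non-unit is a junk value. *)
Definition totq_map (A B : comNzRingType) (phi : A -> B) (u : totq A) : totq B :=
  totq_inj (phi (TotalQuotient.num (repr u))) /
  totq_inj (phi (TotalQuotient.den (repr u))).

Section TotalQuotientMap.
Variables (A B : comNzRingType) (phi : {rmorphism A -> B}).
Hypothesis phi_reg : forall a, GRing.lreg a -> GRing.lreg (phi a).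

Lemma totq_mapE a b : GRing.lreg b ->
  totq_map phi (totq_inj a / totq_inj b) = totq_inj (phi a) / totq_inj (phi b).
Proof.
move=> hb; rewrite -(totq_fracE a hb) /totq_map.
have hd := @TotalQuotient.den_reg _ (repr (TotalQuotient.frac a hb)).
have := TotalQuotient.repr_frac a hb.
move/(congr1 (totq_inj \o phi)); rewrite /= !rmorphM => e.
apply: (mulIr (totq_inj_unit (phi_reg hd))).
rewrite divrK ?totq_inj_unit//; last exact: phi_reg.
apply: (mulIr (totq_inj_unit (phi_reg hb))); rewrite e mulrAC divrK //.
exact/totq_inj_unit/phi_reg.
Qed.

Lemma totq_map_inj a : totq_map phi (totq_inj a) = totq_inj (phi a).
Proof.
have := totq_mapE a (@lreg1 A).
by rewrite !rmorph1 !divr1.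
Qed.

Lemma totq_map_zmod : zmod_morphism (totq_map phi).
Proof.
move=> u v; have [a [b [hb ->]]] := totqP u; have [c [d [hd ->]]] := totqP v.
have [ub ud] := (totq_inj_unit hb, totq_inj_unit hd).
have [ub' ud'] := (totq_inj_unit (phi_reg hb), totq_inj_unit (phi_reg hd)).
have sub (C : comUnitRingType) (x y z t : C) : y \is a GRing.unit ->
    t \is a GRing.unit -> x / y - z / t = (x * t - z * y) / (y * t).
  move=> uy ut; apply: (mulIr (_ : y * t \is a GRing.unit)).
    by rewrite unitrM uy.
  rewrite divrK ?unitrM ?uy//.
  transitivity (x * t * (y / y) - z * y * (t / t)); first by ring.
  by rewrite !divrr// !mulr1.
rewrite sub // -!rmorphM -rmorphB !totq_mapE//; last exact: lregM.
by rewrite sub // -!rmorphM -rmorphB -?rmorphM -?rmorphB.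
Qed.

Lemma totq_map_monoid : monoid_morphism (totq_map phi).
Proof.
split; first by rewrite -(rmorph1 totq_inj) totq_map_inj !rmorph1.
move=> u v; have [a [b [hb ->]]] := totqP u; have [c [d [hd ->]]] := totqP v.
have mm (C : comUnitRingType) (x y z t : C) : y \is a GRing.unit ->
    t \is a GRing.unit -> x / y * (z / t) = (x * z) / (y * t).
  by move=> uy ut; rewrite invrM // mulrACA [t^-1 * _]mulrC.
rewrite mm ?totq_inj_unit// -!rmorphM !totq_mapE//; last exact: lregM.
by rewrite mm ?totq_inj_unit//; [rewrite -!rmorphM | apply: phi_reg..].
Qed.

End TotalQuotientMap.

Section Difference.
Variable B : comNzRingType.
Implicit Types f : {poly B}.

(* In {poly {poly B}} the inner variable plays the role of X (so that f%:P is
   f(X)) and the outer one that of Y; poly_XaY f is f(X + Y). *)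
Definition Delta_Y f : {poly {poly B}} := drop_poly 1 (poly_XaY f - f%:P).

Lemma Delta_YP f : poly_XaY f - f%:P = 'X * Delta_Y f.
Proof.
rewrite /Delta_Y -[LHS](poly_take_drop 1) mulrC.
suff -> : take_poly 1 (poly_XaY f - f%:P) = 0 by rewrite add0r.
apply/polyP => i; rewrite coef_take_poly coef0; case: ltnP => //.
rewrite ltnS leqn0 => /eqP ->; rewrite -horner_coef0 hornerD hornerN hornerC.
by rewrite horner_poly_XaY add0r comp_polyXr subrr.
Qed.

Lemma Delta_Y_uniq f (g : {poly {poly B}}) :
  poly_XaY f - f%:P = 'X * g -> g = Delta_Y f.
Proof.
move=> e; apply/polyP => i; rewrite /Delta_Y e coef_drop_poly coefXM addn1.
by [].
Qed.

Definition Delta (b : B) f : {poly B} := (Delta_Y f).[b%:P].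

Lemma coef_Delta_Y f i : (Delta_Y f)`_i = f^`N(i.+1).
Proof.
rewrite /Delta_Y coef_drop_poly addn1 coefB coefC /= subr0.
have -> : poly_XaY f = \poly_(i < size f) f^`N(i).
  rewrite poly_def /poly_XaY addrC /comp_poly nderiv_taylor; last exact: commr_polyX.
  rewrite !size_map_polyC; apply: eq_bigr => j _.
  by rewrite !nderivn_map horner_map /= -/(comp_poly _ _) comp_polyXr mul_polyC.
by rewrite coef_poly; case: ltnP => // h; rewrite nderivn_poly0.
Qed.

Lemma DeltaE b f n : (size f <= n)%N ->
  Delta b f = \sum_(j < n) b ^+ j *: f^`N(j.+1).
Proof.
move=> hn; rewrite /Delta (@horner_coef_wide _ n).
  apply: eq_bigr => j _; rewrite coef_Delta_Y -mul_polyC mulrC.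
  by rewrite rmorphXn.
apply/leq_sizeP => j hj; rewrite coef_Delta_Y nderivn_poly0//.
by rewrite (leq_trans hn)// leqW.
Qed.

Lemma Delta0 f : Delta 0 f = f^`().
Proof.
by rewrite /Delta horner_coef0 coef_Delta_Y nderivn1.
Qed.

Lemma nderivnC2 f i j : f^`N(i)^`N(j) = f^`N(j)^`N(i).
Proof.
have bb m n k : ('C(m + (n + k), m) * 'C(n + k, n) * (m`! * n`! * k`!) =
    (m + (n + k))`!)%N.
  have e1 := bin_fact (leq_addr (n + k) m); have e2 := bin_fact (leq_addr k n).
  rewrite !addKn in e1 e2; rewrite -e1 -e2.
  by rewrite -!mulnA; congr (_ * _)%N; rewrite mulnCA; congr (_ * _)%N; rewrite mulnCA.
apply/polyP => k; rewrite !coef_nderivn addnCA -!mulrnA; congr (_ *+ _).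
apply/eqP; rewrite -(eqn_pmul2r (_ : 0 < i`! * j`! * k`!)%N) ?muln_gt0 ?fact_gt0//.
by have := bb i j k; rewrite [addn i _]addnCA => ->; rewrite (mulnC i`!) bb.
Qed.

Lemma Delta_comm a b f : Delta a (Delta b f) = Delta b (Delta a f).
Proof.
have szD c : (size (Delta c f) <= size f)%N.
  rewrite (DeltaE c (leqnn _)); apply: (leq_trans (size_sum _ _ _)).
  apply/bigmax_leqP => j _; apply: (leq_trans (size_scale_leq _ _)).
  apply/leq_sizeP => k hk; rewrite coef_nderivn nth_default ?mul0rn//.
  by rewrite (leq_trans hk)// leq_addl.
rewrite !(DeltaE _ (szD _)) !(DeltaE _ (leqnn (size f))).
under eq_bigr do rewrite linear_sum scaler_sumr.
rewrite exchange_big; apply: eq_bigr => i _ /=.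
rewrite linear_sum scaler_sumr; apply: eq_bigr => j _.
by rewrite !linearZ /= !scalerA mulrC nderivnC2.
Qed.

Lemma DeltaZ a c f : Delta a (c *: f) = c *: Delta a f.
Proof.
rewrite (@DeltaE _ _ (size f)) ?size_scale_leq// (DeltaE _ (leqnn _)).
rewrite scaler_sumr; apply: eq_bigr => j _.
by rewrite linearZ /= !scalerA mulrC.
Qed.

End Difference.

Local Open Scope mset_scope.

Section MultisetFacts.
Variable K : choiceType.
Implicit Types S T U V W : {mset K}.

Lemma perm_msetD S T : perm_eq (S `+` T) (S ++ T).
Proof. by apply/allP => x _ /=; rewrite count_cat !count_mem_mset msetE2. Qed.

Lemma size_msetD S T : size (S `+` T) = (size S + size T)%N.
Proof. by rewrite (perm_size (perm_msetD S T)) size_cat. Qed.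

Lemma size_mset1D s S : size (s +` S) = (size S).+1.
Proof. by rewrite size_msetD enum_msetn. Qed.

Lemma size_msubset S T : S `<=` T -> (size S <= size T)%N.
Proof. by move=> h; rewrite -(msetBDK h) size_msetD leq_addl. Qed.

Lemma prod_mset1D (B : comNzRingType) (F : K -> B) s S :
  \prod_(t <- s +` S) F t = F s * \prod_(t <- S) F t.
Proof. by rewrite (perm_big _ (perm_msetD _ _)) big_cat enum_msetn big_seq1. Qed.

Lemma mset1D_inj s : injective (fun S : {mset K} => s +` S).
Proof. exact: can_inj (msetDKB _). Qed.

Lemma mset1D_exchange s s' S S' : s' +` S' = s +` S -> s' != s ->
  exists2 U, S = s' +` U & S' = s +` U.
Proof.
move=> e /negbTE ss'.
have eP x : ((x == s') + S' x = (x == s) + S x)%N by rewrite -!mset1DE e.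
have eS : S = s' +` (S `\ s').
  by rewrite msetB1K// in_mset; have := eP s'; rewrite eqxx ss' add0n => <-.
exists (S `\ s') => //; apply/msetP => x; move: (eP x); rewrite {1}eS !mset1DE.
lia.
Qed.

Lemma msubset1DP s T U : T `<=` s +` U ->
  T `<=` U \/ exists2 V, T = s +` V & V `<=` U.
Proof.
move=> sT; have [sT'|sT'] := boolP (s \in T); [right|left].
  have eT : T = s +` (T `\ s) by rewrite msetB1K.
  exists (T `\ s) => //; apply/msubsetP => x; have := msubsetP sT x.
  by rewrite {1}eT !mset1DE; lia.
apply/msubsetP => x; have := msubsetP sT x; rewrite mset1DE.
by have [->|] := eqVneq x s; move: sT'; rewrite in_mset; lia.
Qed.

Lemma msubsetD1r s T U : T `<=` U -> T `<=` s +` U.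
Proof.
move=> /msubsetP sT; apply/msubsetP => x.
by rewrite mset1DE (leq_trans (sT x))// leq_addl.
Qed.

Lemma msubset_swap U V W : W `<=` V -> V `<=` U ->
  [/\ W `+` (U `\` V) `<=` U, W `<=` W `+` (U `\` V)
    & U `\` (W `+` (U `\` V)) = V `\` W].
Proof.
move=> /msubsetP sW /msubsetP sV.
split; [apply/msubsetP|apply/msubsetP|apply/msetP] => x;
  by have := sW x; have := sV x; rewrite !msetE2; lia.
Qed.

End MultisetFacts.

Section IntegerValued.
Variable A : comNzRingType.
Implicit Types (f : {poly totq A}) (S T : {mset A}).

Definition Int f : Prop := forall a : A, exists b : A, f.[totq_inj a] = totq_inj b.

(* The recursion on |S|, as an inductive predicate; IntS_mset0 and IntS_add
   below are the defining equations, the latter for every choice of the last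
   adjoined element. *)
Inductive IntS : {mset A} -> {poly totq A} -> Prop :=
| IntS_empty f : Int f -> IntS mset0 f
| IntS_adjoin s S f :
    IntS S f ->
    (forall T (y : A), T `<=` S ->
       IntS T (totq_inj y *:
               Delta (totq_inj (y * s * \prod_(t <- S `\` T) t)) f)) ->
    IntS (s +` S) f.

Lemma IntS_mset0 f : IntS mset0 f <-> Int f.
Proof.
split=> [h|]; last exact: IntS_empty.
inversion h as [g hg e1 e2|s S g hS hT e1 e2] => //.
by have /(congr1 (fun M : {mset A} => M s)) := e1; rewrite mset1DE eqxx mset0E.
Qed.

Lemma IntS_add s S f :
  IntS (s +` S) f <->
  IntS S f /\
  (forall T (y : A), T `<=` S ->
     IntS T (totq_inj y *:
             Delta (totq_inj (y * s * \prod_(t <- S `\` T) t)) f)).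
Proof.
split=> [|[]]; last exact: IntS_adjoin.
have [N] := ubnP (size S); elim: N s S f => // N IH s S f ltSN hsS.
inversion hsS as [g hg e1 e2|s' S' g hS' hT' e1 e2].
  by have /(congr1 (fun M : {mset A} => M s)) := e1; rewrite mset1DE eqxx mset0E.
have [ss'|ss'] := eqVneq s' s.
  by move: e1 hS' hT'; rewrite ss' => /mset1D_inj ->.
have [U eS eS'] := mset1D_exchange e1 ss'; clear e1; subst S S'.
move: ltSN; rewrite size_mset1D ltnS => ltU.
have [hU hUT] := IH s U f ltU hS'.
have szU T : T `<=` U -> (size T < N)%N.
  by move=> /size_msubset/leq_ltn_trans; apply.
split=> [|T y /msubset1DP[sTU|[V -> sV]]].
- apply: (IntS_adjoin hU) => T y sT.
  have := hT' (s +` T) y (msetDS _ sT); rewrite msetBDl => h.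
  exact: (IH _ _ _ (szU _ sT) h).1.
- have := hT' T y (msubsetD1r s sTU).
  rewrite -(msetDBA (msetn 1 s) sTU) -(msetDBA (msetn 1 s') sTU) !prod_mset1D.
  by rewrite (mulrACA y s').
rewrite msetBDl; apply: (IntS_adjoin (hUT V y sV)) => W z sW.
have [sW' sWW eW] := msubset_swap sW sV.
rewrite DeltaZ Delta_comm scalerA (mulrC (totq_inj z)) -scalerA -DeltaZ.
have := hT' (s +` (W `+` (U `\` V))) z (msetDS _ sW'); rewrite msetBDl eW => h.
by have := (IH _ _ _ (szU _ sW') h).2 W y sWW; rewrite msetDKB.
Qed.

End IntegerValued.

From mathcomp Require Import mpoly ssrcomplements.

Section RhoRing.
Variables (R : comNzRingType) (n : nat) (r : 'I_n -> R).

(* The ideal (T_1 (T_1 - r_1), ..., T_n (T_n - r_n)) of R[T_1, ..., T_n]. *)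
Definition rho_ideal : {pred {mpoly R[n]}} :=
  fun p => `[< exists q : 'I_n -> {mpoly R[n]},
                 p = \sum_i q i * ('X_i * ('X_i - (r i)%:MP)) >].

Lemma rho_idealP p :
  reflect (exists q : 'I_n -> {mpoly R[n]},
             p = \sum_i q i * ('X_i * ('X_i - (r i)%:MP)))
          (p \in rho_ideal).
Proof. exact: asboolP. Qed.

Lemma rho_ideal_closed : idealr_closed rho_ideal.
Proof.
split.
- apply/rho_idealP; exists (fun=> 0).
  by rewrite big1 // => i _; rewrite mul0r.
- apply/rho_idealP => -[q /(congr1 (meval (fun=> 0)))].
  rewrite rmorph1 rmorph_sum big1 => [/eqP|i _]; first by rewrite oner_eq0.
  by rewrite !rmorphM /= mevalXU mul0r mulr0.
- move=> a u v; move=> /rho_idealP[p ->] /rho_idealP[q ->].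
  apply/rho_idealP; exists (fun i => a * p i + q i).
  rewrite mulr_sumr -big_split; apply: eq_bigr => i _.
  by rewrite [RHS]mulrDl -[X in _ = X + _]mulrA.
Qed.

HB.instance Definition _ := isIdealr.Build {mpoly R[n]} rho_ideal rho_ideal_closed.

Definition rho_ring := {ideal_quot rho_ideal}.
HB.instance Definition _ := GRing.ComNzRing.on rho_ring.

Definition rho_const (a : R) : rho_ring := \pi_rho_ring a%:MP.
Definition rho (i : 'I_n) : rho_ring := \pi_rho_ring 'X_i.
Definition rho_set (T : {set 'I_n}) : rho_ring := \prod_(i in T) rho i.

Lemma rho_const_zmod : zmod_morphism rho_const.
Proof. by move=> a b; rewrite /rho_const !rmorphB. Qed.

Lemma rho_const_monoid : monoid_morphism rho_const.
Proof. by split=> [|a b]; rewrite /rho_const ?rmorph1 ?rmorphM. Qed.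

HB.instance Definition _ := GRing.isZmodMorphism.Build R rho_ring rho_const
  rho_const_zmod.
HB.instance Definition _ := GRing.isMonoidMorphism.Build R rho_ring rho_const
  rho_const_monoid.

Lemma rho_sqr i : rho i * rho i = rho_const (r i) * rho i.
Proof.
apply/eqP; rewrite -subr_eq0 -mulrBl mulrC /rho /rho_const -rmorphB -rmorphM.
rewrite -(rmorph0 (\pi_rho_ring)) /= -Quotient.idealrBE subr0.
apply/rho_idealP; exists (fun j => (j == i)%:R).
rewrite (bigD1 i) //= eqxx mul1r big1 ?addr0 // => j /negPf ->.
by rewrite mul0r.
Qed.

(* R[rho] is free over R with basis the rho_T; rho_coef T p is the coefficient
   at rho_T of the class of p. *)
Definition mnm_set (m : 'X_{1..n}) : {set 'I_n} := [set i | m i != 0%N].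

Definition mnm_coef (T : {set 'I_n}) (m : 'X_{1..n}) : R :=
  if mnm_set m == T then \prod_i r i ^+ (m i).-1 else 0.

Definition rho_coef (T : {set 'I_n}) (p : {mpoly R[n]}) : R :=
  \sum_(m <- msupp p) p@_m * mnm_coef T m.

Lemma rho_coefE T p k : (msize p <= k)%N ->
  rho_coef T p = \sum_(m : 'X_{1..n < k}) p@_m * mnm_coef T m.
Proof.
move=> le_pk; set I : subFinType _ := 'X_{1..n < k}.
rewrite /rho_coef (big_mksub I) ?msupp_uniq //=; first last.
  by move=> x /msize_mdeg_lt /leq_trans; apply.
by rewrite big_rmcond //= => j /memN_msupp_eq0 ->; rewrite mul0r.
Qed.

Lemma rho_coef_lin T c p q :
  rho_coef T (c *: p + q) = c * rho_coef T p + rho_coef T q.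
Proof.
pose k := maxn (maxn (msize p) (msize q)) (msize (c *: p + q)).
rewrite !(@rho_coefE T _ k) ?leq_max ?leqnn ?orbT // mulr_sumr -big_split.
by apply: eq_bigr => m _; rewrite mcoeffD mcoeffZ mulrDl mulrA.
Qed.

Lemma rho_coefD T : {morph rho_coef T : p q / p + q}.
Proof. by move=> p q; rewrite -[p]scale1r rho_coef_lin mul1r scale1r. Qed.

Lemma rho_coef0 T : rho_coef T 0 = 0.
Proof. by rewrite /rho_coef msupp0 big_nil. Qed.

Lemma rho_coefZ T c p : rho_coef T (c *: p) = c * rho_coef T p.
Proof. by rewrite -[c *: p]addr0 rho_coef_lin rho_coef0 addr0. Qed.

Lemma rho_coef_sum T (I : Type) (s : seq I) (P : pred I) (F : I -> {mpoly R[n]}) :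
  rho_coef T (\sum_(i <- s | P i) F i) = \sum_(i <- s | P i) rho_coef T (F i).
Proof. exact: (big_morph _ (rho_coefD T) (rho_coef0 T)). Qed.

Lemma rho_coefX T m : rho_coef T 'X_[m] = mnm_coef T m.
Proof. by rewrite /rho_coef msuppX big_seq1 mcoeffX eqxx mul1r. Qed.

Lemma mnm_coefS T i m :
  mnm_coef T (m + (U_(i) + U_(i))) = r i * mnm_coef T (m + U_(i)).
Proof.
rewrite /mnm_coef.
have -> : mnm_set (m + (U_(i) + U_(i))) = mnm_set (m + U_(i)).
  by apply/setP => j; rewrite !inE !mnmDE !mnm1E; case: (i == j); lia.
case: ifP => _; last by rewrite mulr0.
rewrite (bigD1 i) //= [in RHS](bigD1 i) //= mulrA -exprS.
congr (_ * _).
  by rewrite !mnmDE !mnm1E eqxx; congr (_ ^+ _); lia.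
apply: eq_bigr => j /negPf ji; rewrite !mnmDE !mnm1E eq_sym ji.
by congr (_ ^+ _); lia.
Qed.

Lemma rho_coef_ideal T p : p \in rho_ideal -> rho_coef T p = 0.
Proof.
move=> /rho_idealP[q ->]; rewrite rho_coef_sum big1 // => i _.
rewrite [q i]mpolyE mulr_suml rho_coef_sum big1 // => m _.
have -> : (q i)@_m *: 'X_[m] * ('X_i * ('X_i - (r i)%:MP)) =
    (q i)@_m *: ('X_[m + (U_(i) + U_(i))] + - r i *: 'X_[m + U_(i)]).
  rewrite -scalerAl; congr (_ *: _); rewrite !mpolyXD -mul_mpolyC mpolyCN.
  by ring.
rewrite rho_coefZ rho_coefD rho_coefZ !rho_coefX mnm_coefS mulNr subrr.
by rewrite mulr0.
Qed.

Lemma rhoX i k : rho i ^+ k.+1 = rho_const (r i) ^+ k * rho i.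
Proof.
elim: k => [|k IHk]; first by rewrite expr0 mul1r.
by rewrite exprS IHk mulrCA rho_sqr mulrA -exprSr.
Qed.

Lemma pi_rho_X m :
  \pi_rho_ring 'X_[m] =
  rho_const (\prod_i r i ^+ (m i).-1) * rho_set (mnm_set m).
Proof.
rewrite mpolyXE_id rmorph_prod rmorph_prod /rho_set [X in _ * X]big_mkcond.
rewrite -big_split /=.
apply: eq_bigr => i _; rewrite inE !rmorphXn.
by case: (m i) => [|k] /=; rewrite ?mulr1// rhoX.
Qed.

Lemma pi_rho_expand p :
  \pi_rho_ring p = \sum_T rho_const (rho_coef T p) * rho_set T.
Proof.
rewrite {1}[p]mpolyE rmorph_sum.
under [RHS]eq_bigr do rewrite /rho_coef rmorph_sum mulr_suml.
rewrite exchange_big; apply: eq_bigr => m _ /=.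
rewrite -mul_mpolyC rmorphM /= -/(rho_const _) pi_rho_X.
rewrite (bigD1 (mnm_set m)) //= [X in _ + X]big1 => [|T /negPf hT].
  by rewrite addr0 rmorphM /mnm_coef eqxx mulrA.
by rewrite /mnm_coef eq_sym hT mulr0 rmorph0 mul0r.
Qed.

Lemma rho_spans (x : rho_ring) :
  exists a : {set 'I_n} -> R, x = \sum_T rho_const (a T) * rho_set T.
Proof.
by exists (rho_coef^~ (repr x)); rewrite -pi_rho_expand reprK.
Qed.

Lemma rho_free (a : {set 'I_n} -> R) :
  \sum_T rho_const (a T) * rho_set T = 0 -> forall T, a T = 0.
Proof.
pose ind (T : {set 'I_n}) : 'X_{1..n} := [multinom nat_of_bool (i \in T) | i < n].
have indT T : mnm_set (ind T) = T.
  by apply/setP => i; rewrite inE mnmE; case: (i \in T).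
have coef1 T : \prod_i r i ^+ (ind T i).-1 = 1.
  by rewrite big1 // => i _; rewrite mnmE; case: (i \in T).
have -> : \sum_T rho_const (a T) * rho_set T =
    \pi_rho_ring (\sum_T a T *: 'X_[ind T]).
  rewrite rmorph_sum; apply: eq_bigr => T _.
  by rewrite -mul_mpolyC rmorphM /= pi_rho_X indT coef1 rmorph1 mul1r.
rewrite -(rmorph0 (\pi_rho_ring)) => /eqP.
rewrite -Quotient.idealrBE subr0 => h T; have := rho_coef_ideal T h.
rewrite rho_coef_sum (bigD1 T) //= rho_coefZ rho_coefX /mnm_coef indT eqxx.
rewrite coef1 mulr1 big1 ?addr0 // => T' /negPf hT'.
by rewrite rho_coefZ rho_coefX /mnm_coef indT hT' mulr0.
Qed.

Lemma rho_const_reg (b : R) : GRing.lreg b -> GRing.lreg (rho_const b).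
Proof.
move=> hb; apply: mulrI0_lreg => x; have [a ->] := rho_spans x.
rewrite mulr_sumr => e; rewrite big1 // => T _.
suff -> : a T = 0 by rewrite rmorph0 mul0r.
apply/eqP; rewrite -(mulrI_eq0 _ hb); apply/eqP.
apply: (rho_free (a := fun T => b * a T)); rewrite -[RHS]e.
by apply: eq_bigr => T' _; rewrite rmorphM mulrA.
Qed.

End RhoRing.

(* The canonical map T(R) -> T(R[rho]). *)
Definition rho_totq (R : comNzRingType) (n : nat) (r : 'I_n -> R) :
  totq R -> totq (rho_ring r) := totq_map (rho_const r).

Section RhoTotalQuotient.
Variables (R : comNzRingType) (n : nat) (r : 'I_n -> R).

HB.instance Definition _ :=
  GRing.isZmodMorphism.Build (totq R) (totq (rho_ring r)) (rho_totq r)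
    (@totq_map_zmod _ _ (rho_const r) (@rho_const_reg R n r)).
HB.instance Definition _ :=
  GRing.isMonoidMorphism.Build (totq R) (totq (rho_ring r)) (rho_totq r)
    (@totq_map_monoid _ _ (rho_const r) (@rho_const_reg R n r)).

(* \sum_T g_T rho_T in T(R[rho])[X]. *)
Definition rho_comb (g : {set 'I_n} -> {poly totq R}) :
    {poly totq (rho_ring r)} :=
  \sum_(T : {set 'I_n}) map_poly (rho_totq r) (g T) * (totq_inj (rho_set r T))%:P.

(* M is the internal direct sum of the N_T rho_T. *)
Definition is_rho_dsum (M : {poly totq (rho_ring r)} -> Prop)
    (N : {set 'I_n} -> {poly totq R} -> Prop) : Prop :=
  (forall f, M f <-> exists2 g, (forall T, N T (g T)) & f = rho_comb g) /\
  (forall g h, (forall T, N T (g T)) -> (forall T, N T (h T)) ->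
     rho_comb g = rho_comb h -> forall T, g T = h T).

End RhoTotalQuotient.

Definition mset_map (K L : choiceType) (f : K -> L) (S : {mset K}) : {mset L} :=
  seq_mset [seq f x | x <- S].

(* r_T, with multiplicities when some of the r_i coincide *)
Definition sub_family (R : choiceType) (n : nat) (r : 'I_n -> R)
    (T : {set 'I_n}) : {mset R} :=
  seq_mset [seq r i | i <- enum T].

(* Main.v *)
From HB Require Import structures.
Require Import Defs.
From mathcomp Require Import all_boot all_order all_algebra.
From mathcomp Require Import finmap multiset.
From mathcomp Require Import generic_quotient ring.
From mathcomp Require mpoly.

(** The ring R[rho_1, ..., rho_n] arises from R by adjoining the rho_i one at a
time, so the heart of the matter is a quadratic extension
B = A (+) A rho with rho^2 = r rho, for which
  Int(B; S) = Int(A; S + r) (+) Int(A; S) rho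
(IntS_quad).  Iterating this along the tower turns the multiset S at the top
into S + r_(n - T) at the coefficient of rho_T, because each rho_i that is
missing from T contributes its r_i (rho_decompositionS).

In the quadratic case everything rests on one principle: if rho x = rho y then
rho p(x) = rho p(y) for every polynomial p.  As rho (a + b rho) = rho (a + b r),
an expression in a + b rho multiplied by rho can be computed in A.  For
f = g + h rho this gives (quad_poly_horner)
  f(a + b rho) = g(a) + rho (b Delta_(br) g(a) + h(a + br)),
so that f is integer-valued exactly when g, h and all b Delta_(br) g are: this
is the case S = 0.  For the recursion defining Int(-; S) one also needs
y Delta_(yu) f for y = c + d rho and u in A.  The cocycle identity
Delta_cocycle splits it, and the same principle yields (Delta_quad_poly)
  c Delta_(cu) g + rho ((d Delta_(dru) g)(X + cu)
                         + (c + dr) Delta_((c + dr)u) h).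
The sets Int(A; T) are stable under sums and under translation of the variable
by elements of A, so by induction the conditions imposed by this polynomial
separate into conditions on g and on h.  Those on g run over the sub-multisets
T and T + r of S + r: the first come from the coefficient of rho, the second
from the constant coefficient.

Finally, every polynomial over T(B) has the form g + h rho with g, h over T(A):
a regular element a + b rho divides its norm a (a + br), and this norm is
regular in A (quad_norm_reg, totq_quad_span). *)

Set Implicit Arguments.
Unset Strict Implicit.
Unset Printing Implicit Defensive.

Import GRing.Theory.

Local Open Scope ring_scope.
Local Open Scope mset_scope.

(** * Calculus of the difference operators *)

(** The powers of x and y agree after multiplication by c: in c x^(k+1) one
factor x at a time can be traded for y. *)
Lemma horner_absorb (B : comNzRingType) (c x y : B) (f : {poly B}) :
  c * x = c * y -> c * f.[x] = c * f.[y].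
Proof.
move=> e; elim/poly_ind: f => [|f a IH]; first by rewrite !horner0.
by rewrite !hornerE !mulrDr !mulrA IH mulrAC e mulrAC.
Qed.

Section DeltaCalculus.
Variable B : comNzRingType.
Implicit Types (f g : {poly B}) (a b c u x y z : B).

Definition shift a f : {poly B} := f \Po ('X + a%:P).

Lemma shiftD a : {morph shift a : f g / f + g}.
Proof. by move=> f g; rewrite /shift comp_polyD. Qed.

Lemma shiftZ a c f : shift a (c *: f) = c *: shift a f.
Proof. exact: comp_polyZ. Qed.

Lemma shift_horner a b f : (shift a f).[b] = f.[b + a].
Proof. by rewrite /shift horner_comp !hornerE. Qed.

Lemma shift0 f : shift 0 f = f.
Proof. by rewrite /shift addr0 comp_polyXr. Qed.

Lemma shift_shift a b f : shift a (shift b f) = shift (a + b) f.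
Proof.
rewrite /shift -comp_polyA comp_polyD comp_polyX comp_polyC polyCD.
by rewrite addrA.
Qed.

Lemma DeltaP b f : b *: Delta b f = shift b f - f.
Proof.
have /(congr1 (horner^~ b%:P)) := Delta_YP f.
rewrite hornerD hornerN hornerC hornerM hornerX horner_poly_XaY => e.
by rewrite -mul_polyC -e /shift [b%:P + _]addrC.
Qed.

Lemma DeltaD b : {morph Delta b : f g / f + g}.
Proof.
move=> f g; rewrite (DeltaE _ (size_polyD f g)).
rewrite (DeltaE _ (leq_maxl (size f) (size g))) (DeltaE _ (leq_maxr (size f) (size g))).
by rewrite -big_split; apply: eq_bigr => i _; rewrite nderivnD scalerDr.
Qed.

Lemma DeltaC b c : Delta b c%:P = 0.
Proof. by rewrite (DeltaE _ (size_polyC_leq1 _)) big_ord1 nderivnC scaler0. Qed.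

(** Twisted Leibniz rule for the product with X.  The identities below hold for
all b, including zero divisors, so they cannot be obtained by cancelling b in
DeltaP; this rule allows induction on the polynomial instead. *)
Lemma DeltaMX b f : Delta b (f * 'X) = Delta b f * 'X + shift b f.
Proof.
have -> : shift b f = (poly_XaY f).[b%:P] by rewrite horner_poly_XaY addrC.
suff e : Delta_Y (f * 'X) = Delta_Y f * 'X%:P + poly_XaY f.
  by rewrite /Delta e hornerD hornerM hornerC.
symmetry; apply: Delta_Y_uniq.
rewrite mulrDr mulrA -Delta_YP /poly_XaY rmorphM /= map_polyX comp_polyM comp_polyX.
by rewrite polyCM; ring.
Qed.

Lemma shift_Delta a b f : Delta b (shift a f) = shift a (Delta b f).
Proof.
elim/poly_ind: f => [|f c IH].
  by rewrite /shift comp_poly0 !DeltaC comp_poly0.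
have -> : shift a (f * 'X + c%:P) = shift a f * 'X + a *: shift a f + c%:P.
  rewrite /shift comp_polyD comp_polyM comp_polyX comp_polyC -mul_polyC.
  by ring.
rewrite !DeltaD !DeltaC !DeltaMX DeltaZ IH shift_shift !addr0 shiftD.
have -> : shift a (Delta b f * 'X) =
    shift a (Delta b f) * 'X + a *: shift a (Delta b f).
  by rewrite /shift comp_polyM comp_polyX -mul_polyC; ring.
by rewrite shift_shift [b + a]addrC addrAC.
Qed.

(** For regular u this is the splitting of f(X + zu + wu) - f(X) into an
increment by zu followed by one by wu, divided by u. *)
Lemma Delta_cocycle u z w f :
  (z + w) *: Delta ((z + w) * u) f =
  z *: Delta (z * u) f + w *: shift (z * u) (Delta (w * u) f).
Proof.
elim/poly_ind: f => [|f c IH]; first by rewrite !DeltaC /shift comp_poly0 !scaler0 addr0.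
rewrite !DeltaD !DeltaC !addr0 !DeltaMX shiftD shift_shift -mulrDl !scalerDr scalerAl IH.
have /(congr1 (shift (z * u))) := DeltaP (w * u) f.
rewrite /shift comp_polyB -!/(shift _ _) shiftZ shift_shift -mulrDl => /eqP.
rewrite eq_sym subr_eq => /eqP e.
have -> : shift (z * u) (Delta (w * u) f * 'X) =
   shift (z * u) (Delta (w * u) f) * ('X + (z * u)%:P).
  by rewrite /shift comp_polyM comp_polyX.
by rewrite e -!mul_polyC !polyCM !polyCD; ring.
Qed.

Lemma Delta_absorb c x y f : c * x = c * y -> c *: Delta x f = c *: Delta y f.
Proof.
move=> e; rewrite -!mul_polyC /Delta; apply: horner_absorb.
by rewrite -!polyCM e.
Qed.

End DeltaCalculus.

Lemma Delta_map (B C : comNzRingType) (phi : {rmorphism B -> C}) b f :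
  map_poly phi (Delta b f) = Delta (phi b) (map_poly phi f).
Proof.
rewrite (DeltaE _ (leqnn _)) (DeltaE _ (size_poly _ _ : (_ <= size f)%N)).
rewrite rmorph_sum; apply: eq_bigr => i _ /=.
by rewrite map_polyZ rmorphXn nderivn_map.
Qed.

Lemma shift_map (B C : comNzRingType) (phi : {rmorphism B -> C}) b f :
  map_poly phi (shift b f) = shift (phi b) (map_poly phi f).
Proof. by rewrite /shift map_comp_poly rmorphD /= map_polyX map_polyC. Qed.

(** * Closure properties of the sets Int(A; S) *)

(** Membership in Int(A; s + S) refers to Int(A; T) for all T contained in S, S
itself included, which is the induction hypothesis offered here. *)
Lemma mset_ind_sub (K : choiceType) (P : {mset K} -> Prop) :
  P mset0 ->
  (forall s S, (forall T, T `<=` S -> P T) -> P (s +` S)) ->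
  forall S, P S.
Proof.
move=> P0 PS S; have [N] := ubnP (size S); elim: N S => // N IH S leSN.
have [->//|[s sS]] := mset_0Vmem S.
rewrite -(msetB1K sS) in leSN *; apply: PS => T /size_msubset leT.
by apply: IH; rewrite size_mset1D ltnS in leSN; apply: leq_ltn_trans leSN.
Qed.

Section IntegerValuedClosure.
Variable A : comNzRingType.
Implicit Types (f g : {poly totq A}) (S T : {mset A}) (a y : A).

Lemma IntS_linear S y f g : IntS S f -> IntS S g -> IntS S (totq_inj y *: f + g).
Proof.
move: S f g; elim/mset_ind_sub => [f g|s S IH f g].
  move=> /IntS_mset0 hf /IntS_mset0 hg; apply/IntS_mset0 => a.
  have [b eb] := hf a; have [c ec] := hg a; exists (y * b + c).
  by rewrite hornerD hornerZ eb ec rmorphD rmorphM.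
move=> /IntS_add[hf hfT] /IntS_add[hg hgT]; apply/IntS_add; split.
  by apply: IH => //; rewrite msubset_refl.
move=> T z sT; rewrite DeltaD DeltaZ scalerDr scalerA mulrC -scalerA.
by apply: IH; [|apply: hfT|apply: hgT].
Qed.

Lemma IntSD S f g : IntS S f -> IntS S g -> IntS S (f + g).
Proof. by move=> hf hg; rewrite -[f]scale1r -(rmorph1 totq_inj); apply: IntS_linear. Qed.

Lemma IntSB S f g : IntS S f -> IntS S g -> IntS S (f - g).
Proof.
move=> hf hg; rewrite addrC -scaleN1r -(rmorph1 totq_inj) -rmorphN.
exact: IntS_linear.
Qed.

Lemma IntS_shift S a f : IntS S f -> IntS S (shift (totq_inj a) f).
Proof.
move: S f; elim/mset_ind_sub => [f|s S IH f].
  move=> /IntS_mset0 hf; apply/IntS_mset0 => b; have [c ec] := hf (b + a).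
  by exists c; rewrite shift_horner -rmorphD.
move=> /IntS_add[hf hfT]; apply/IntS_add; split.
  by apply: IH => //; rewrite msubset_refl.
by move=> T y sT; rewrite shift_Delta -shiftZ; apply: IH => //; apply: hfT.
Qed.

End IntegerValuedClosure.

(** * Images of multisets *)

Section MsetMap.
Variables (K L : choiceType) (f : K -> L).
Implicit Types S T : {mset K}.

Lemma mset_mapE S x : mset_map f S x = count (fun y => f y == x) S.
Proof. by rewrite /mset_map mset_seqE count_map. Qed.

Lemma mset_mapD S T : mset_map f (S `+` T) = mset_map f S `+` mset_map f T.
Proof.
apply/msetP => x; rewrite msetE2 !mset_mapE -count_cat.
by apply/permP/perm_msetD.
Qed.

Lemma mset_map0 : mset_map f mset0 = mset0.
Proof. by apply/msetP => x; rewrite mset_mapE enum_mset0 mset0E. Qed.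

Lemma mset_map1D s S : mset_map f (s +` S) = f s +` mset_map f S.
Proof.
by rewrite mset_mapD; congr (_ `+` _); apply/msetP => x;
  rewrite mset_mapE enum_msetn /= msetnE eq_sym addn0; case: eqP.
Qed.

Lemma msubset_map S T : T `<=` S -> mset_map f T `<=` mset_map f S.
Proof.
by move=> /msetBDK <-; apply/msubsetP => x; rewrite mset_mapD msetE2 leq_addl.
Qed.

Lemma mset_mapB S T : T `<=` S ->
  mset_map f S `\` mset_map f T = mset_map f (S `\` T).
Proof. by move=> sT; rewrite -{1}(msetBDK sT) mset_mapD msetDC msetDKB. Qed.

Lemma msubset_mapP S (T : {mset L}) : T `<=` mset_map f S ->
  exists2 U, U `<=` S & T = mset_map f U.
Proof.
move: S T; elim/mset_ind_sub => [|s S IH] T.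
  rewrite mset_map0 => T0; exists mset0; rewrite ?msubset_refl // mset_map0.
  by apply/eqP; rewrite -msubset0.
rewrite mset_map1D => /msubset1DP[|[V -> sV]].
  by case/IH => [|U sU ->]; rewrite ?msubset_refl //; exists U; rewrite ?msubsetD1r.
have [|U sU ->] := IH S _ V sV; rewrite ?msubset_refl //.
by exists (s +` U); rewrite ?mset_map1D // msetDS.
Qed.

End MsetMap.

Lemma prod_mset_map (A B : comNzRingType) (phi : {rmorphism A -> B}) (S : {mset A}) :
  \prod_(t <- mset_map phi S) t = phi (\prod_(t <- S) t).
Proof.
by rewrite (perm_big _ (perm_eq_seq_mset _)) big_map rmorph_prod.
Qed.

(** The recursion for a multiset that comes from A: its sub-multisets come from A
too, so only y ranges over the larger ring. *)
Lemma IntS_add_map (A B : comNzRingType) (phi : {rmorphism A -> B}) s (S : {mset A}) f :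
  IntS (mset_map phi (s +` S)) f <->
  IntS (mset_map phi S) f /\
  (forall T (y : B), T `<=` S -> IntS (mset_map phi T)
     (totq_inj y *: Delta (totq_inj (y * phi (s * \prod_(t <- S `\` T) t))) f)).
Proof.
rewrite mset_map1D IntS_add; split=> -[h hT]; split=> // T y.
  move=> sT; have := hT _ y (msubset_map phi sT).
  by rewrite (mset_mapB phi sT) prod_mset_map -mulrA -(rmorphM phi).
case/msubset_mapP => U sU ->; rewrite (mset_mapB phi sU) prod_mset_map.
by rewrite -mulrA -(rmorphM phi); apply: hT.
Qed.

(** * Extensions to total quotient rings *)

Lemma totq_common (A : comNzRingType) (u v : totq A) :
  exists a b d, [/\ GRing.lreg d, u = totq_inj a / totq_inj d
                  & v = totq_inj b / totq_inj d].
Proof.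
have [a [b [hb ->]]] := totqP u; have [c [d [hd ->]]] := totqP v.
have ub := totq_inj_unit hb; have ud := totq_inj_unit hd.
exists (a * d), (c * b), (b * d); split; first exact: lregM.
  by rewrite !rmorphM invrM // mulrA mulrK.
by rewrite !rmorphM invrM // mulrACA divrr // mulr1.
Qed.

Lemma totq_extension (A B : comNzRingType) (phi : {rmorphism A -> B}) :
  (forall a, GRing.lreg a -> GRing.lreg (phi a)) ->
  exists psi : {rmorphism totq A -> totq B},
    forall a, psi (totq_inj a) = totq_inj (phi a).
Proof.
move=> phi_reg.
pose F := totq_map phi.
pose Fz := GRing.isZmodMorphism.Build _ _ F (totq_map_zmod phi_reg).
pose Fm := GRing.isMonoidMorphism.Build _ _ F (totq_map_monoid phi_reg).
pose psi : {rmorphism totq A -> totq B} := HB.pack F Fz Fm.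
by exists psi => a; apply: totq_map_inj.
Qed.

(** T(A) is a localization of A, and a ring morphism preserves inverses. *)
Lemma totq_rmorph_eq (A : comNzRingType) (C : comUnitRingType)
    (f g : {rmorphism totq A -> C}) :
  (forall a, f (totq_inj a) = g (totq_inj a)) -> f =1 g.
Proof.
move=> e u; have [a [b [hb ->]]] := totqP u; have ub := totq_inj_unit hb.
by rewrite !rmorph_div // !e.
Qed.

(** * Adjoining one element *)

(** The identities behind the quadratic case hold for any morphism psi and any
rho with rho^2 = psi r * rho; they will be applied to the total quotient rings. *)
Section QuadraticPolynomials.
Variables (C D : comNzRingType) (psi : {rmorphism C -> D}) (r : C) (rho : D).
Implicit Types (a b c d u v w : C) (f : {poly D}) (g h : {poly C}).

Definition quad_poly g h : {poly D} := map_poly psi g + rho *: map_poly psi h.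

Lemma quad_poly_sum (I : finType) (F G : I -> {poly C}) :
  quad_poly (\sum_i F i) (\sum_i G i) =
  \sum_i map_poly psi (F i) + \sum_i rho *: map_poly psi (G i).
Proof. by rewrite /quad_poly !rmorph_sum scaler_sumr. Qed.

Lemma quad_poly_inj :
  (forall u v, psi u + rho * psi v = 0 -> u = 0 /\ v = 0) ->
  forall g g' h h', quad_poly g h = quad_poly g' h' -> g = g' /\ h = h'.
Proof.
move=> free g g' h h' e; suff e' i : (g - g')`_i = 0 /\ (h - h')`_i = 0.
  by split; apply/eqP; rewrite -subr_eq0; apply/eqP/polyP => i; rewrite coef0;
    case: (e' i).
apply: free; rewrite !coefB !rmorphB mulrBr addrACA -opprD.
have := congr1 (fun p : {poly _} => p`_i) e.
by rewrite !coefD !coefZ !coef_map => ->; rewrite subrr.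
Qed.

Lemma quad_poly_span :
  (forall x, exists u v, x = psi u + rho * psi v) ->
  forall f, exists g h, f = quad_poly g h.
Proof.
move=> span; elim/poly_ind => [|f c [g [h ->]]].
  by exists 0, 0; rewrite /quad_poly !rmorph0 scaler0 addr0.
have [u [v ->]] := span c.
exists (g * 'X + u%:P), (h * 'X + v%:P).
rewrite /quad_poly !(rmorphD (map_poly psi)) !(rmorphM (map_poly psi)) /=.
rewrite !map_polyX !map_polyC /= polyCD polyCM -!mul_polyC.
by rewrite mulrDl mulrDr -mulrA addrACA.
Qed.

Hypothesis rho_sqr : rho * rho = psi r * rho.

Lemma rho_absorb w : rho * (rho * psi w) = rho * psi (w * r).
Proof. by rewrite mulrA rho_sqr rmorphM; ring. Qed.

(** Behind every computation below: after multiplication by rho, the element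
a + b rho may be replaced by a + b r. *)
Lemma rho_absorbD a b : rho * (psi a + rho * psi b) = rho * psi (a + b * r).
Proof. by rewrite mulrDr rho_absorb -mulrDr -rmorphD. Qed.

Lemma Delta_rho d w g :
  (rho * psi d) *: Delta (rho * psi w) (map_poly psi g) =
  rho *: map_poly psi (d *: Delta (w * r) g).
Proof.
rewrite mulrC -scalerA (Delta_absorb _ (rho_absorb w)).
by rewrite -Delta_map map_polyZ !scalerA mulrC.
Qed.

(** The g part is expanded as g(a) + y Delta_y g(a) with y = rho b; the factor rho
in y then absorbs the rho in the index of Delta.  The h part has a factor rho
from the start. *)
Lemma quad_poly_horner g h a b :
  (quad_poly g h).[psi a + rho * psi b] =
  psi g.[a] + rho * psi ((b *: Delta (b * r) g).[a] + h.[a + b * r]).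
Proof.
set y := rho * psi b; set x := psi a.
rewrite /quad_poly hornerD hornerZ.
have -> : rho * (map_poly psi h).[x + y] = rho * psi h.[a + b * r].
  by rewrite -horner_map; apply/horner_absorb/rho_absorbD.
have -> : (map_poly psi g).[x + y] =
    (map_poly psi g).[x] + (y *: Delta y (map_poly psi g)).[x].
  by rewrite DeltaP hornerD hornerN shift_horner addrCA subrr addr0.
rewrite Delta_rho hornerZ !horner_map.
by rewrite -addrA -mulrDr -rmorphD.
Qed.

(** The g part is split by the cocycle identity into the increment c, which lies in
C, and the increment rho d, whose factor rho absorbs the rho in the index.  The
translation by c u is the price of this splitting. *)
Lemma Delta_quad_poly c d u g h :
  (psi c + rho * psi d) *: Delta ((psi c + rho * psi d) * psi u) (quad_poly g h) =
  quad_poly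
    (c *: Delta (c * u) g)
    (shift (c * u) (d *: Delta (d * r * u) g)
     + (c + d * r) *: Delta ((c + d * r) * u) h).
Proof.
set z := psi c; set w := rho * psi d; set v := psi u.
rewrite {1}/quad_poly DeltaD scalerDr DeltaZ (Delta_cocycle v z w).
have -> : (z + w) *: (rho *: Delta ((z + w) * v) (map_poly psi h)) =
    rho *: map_poly psi ((c + d * r) *: Delta ((c + d * r) * u) h).
  have absorb : rho * ((z + w) * v) = rho * psi ((c + d * r) * u).
    by rewrite mulrA rho_absorbD rmorphM mulrA.
  rewrite (Delta_absorb _ absorb) scalerA [_ * rho]mulrC rho_absorbD.
  by rewrite map_polyZ Delta_map scalerA.
have -> : w *: shift (z * v) (Delta (w * v) (map_poly psi g)) =
    rho *: map_poly psi (shift (c * u) (d *: Delta (d * r * u) g)).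
  rewrite -shiftZ /w -mulrA -(rmorphM psi d u) Delta_rho mulrAC.
  by rewrite shiftZ shift_map rmorphM.
have -> : z *: Delta (z * v) (map_poly psi g) = map_poly psi (c *: Delta (c * u) g).
  by rewrite map_polyZ Delta_map rmorphM.
by rewrite -addrA -scalerDr -rmorphD.
Qed.

End QuadraticPolynomials.

Lemma IntS_mset1 (A : comNzRingType) (r : A) g :
  IntS (r +` mset0) g <->
  Int g /\ forall y, Int (totq_inj y *: Delta (totq_inj (y * r)) g).
Proof.
rewrite IntS_add IntS_mset0; split=> -[hg hgy]; split=> //.
  move=> y; have := hgy mset0 y (msub0set _).
  by rewrite msetB0 big_mset0 mulr1 IntS_mset0.
move=> T y; rewrite msubset0 => /eqP ->.
by rewrite msetB0 big_mset0 mulr1 IntS_mset0.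
Qed.

(** Here B is free over A with basis (1, rho), where rho^2 = r rho, and psi is the
induced map T(A) -> T(B). *)
Section QuadraticExtension.
Variables (A B : comNzRingType) (phi : {rmorphism A -> B}) (r : A) (rho : B).
Hypothesis rho_sqr : rho * rho = phi r * rho.
Hypothesis quad_span : forall x : B, exists a b, x = phi a + rho * phi b.
Hypothesis quad_free : forall a b, phi a + rho * phi b = 0 -> a = 0 /\ b = 0.
Variable psi : {rmorphism totq A -> totq B}.
Hypothesis psi_inj : forall a, psi (totq_inj a) = totq_inj (phi a).

Let trho : totq B := totq_inj rho.

Lemma trho_sqr : trho * trho = psi (totq_inj r) * trho.
Proof. by rewrite psi_inj -!rmorphM rho_sqr. Qed.

Lemma totq_quad_free (u v : totq A) : psi u + trho * psi v = 0 -> u = 0 /\ v = 0.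
Proof.
have [a [b [d [hd -> ->]]]] := totq_common u v; have ud := totq_inj_unit hd.
rewrite !rmorph_div // mulrA -mulrDl => /(congr1 ( *%R^~ (psi (totq_inj d)))).
rewrite mul0r divrK ?rmorph_unit // !psi_inj -rmorphM -rmorphD.
rewrite -(rmorph0 totq_inj) => /totq_inj_inj /quad_free[-> ->].
by rewrite rmorph0 !mul0r.
Qed.

(** The conjugate of q = a + b rho is a + b r - b rho, because r - rho satisfies the
same equation as rho; their product is a (a + b r).  If t kills this norm, then
regularity of q forces t to kill the conjugate, hence b and a, hence q, so that
t = 0. *)
Lemma quad_norm_reg a b :
  GRing.lreg (phi a + rho * phi b) -> GRing.lreg (a * (a + b * r)).
Proof.
move=> hq; have zero x : (phi a + rho * phi b) * x = 0 -> x = 0.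
  by move/eqP; rewrite (mulrI_eq0 _ hq) => /eqP.
apply: mulrI0_lreg => t Nt.
have e : phi ((a + b * r) * t) + rho * phi (- (b * t)) = 0.
  apply: (zero); transitivity (phi (a * (a + b * r) * t)); last by rewrite Nt rmorph0.
  rewrite !(rmorphM, rmorphD, rmorphN) /=.
  transitivity (phi a * (phi a + phi b * phi r) * phi t +
      phi b * phi b * phi t * (rho * phi r - rho * rho)); first by ring.
  by rewrite rho_sqr [rho * _]mulrC subrr mulr0 addr0.
have [e1 /eqP] := quad_free e; rewrite oppr_eq0 => /eqP e2.
have e3 : a * t = 0.
  by rewrite -e1 mulrDl -[in RHS]mulrA [in RHS](mulrC r) mulrA e2 mul0r addr0.
have : phi t + rho * phi 0 = 0.
  rewrite rmorph0 mulr0 addr0; apply: zero.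
  by rewrite mulrDl -mulrA -!rmorphM e2 e3 rmorph0 mulr0 addr0.
by case/quad_free.
Qed.

(** A denominator is cleared by multiplying with its conjugate. *)
Lemma totq_quad_span (x : totq B) : exists u v, x = psi u + trho * psi v.
Proof.
have [p [q [hq ->]]] := totqP x; have [a [b eq]] := quad_span q.
rewrite eq in hq *; have hN := quad_norm_reg hq.
have [c [d ep]] := quad_span (p * (phi (a + b * r) - rho * phi b)).
exists (totq_inj c / totq_inj (a * (a + b * r))).
exists (totq_inj d / totq_inj (a * (a + b * r))).
have uN := totq_inj_unit hN; have uq := totq_inj_unit hq.
have uN' := rmorph_unit psi uN.
apply: (mulIr uN'); apply: (mulIr uq).
rewrite mulrDl !rmorph_div // mulrA !divrK // mulrAC divrK //.
rewrite !psi_inj -rmorphM -[in RHS]rmorphM -rmorphD -[RHS]rmorphM -ep.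
congr totq_inj; rewrite !(rmorphM, rmorphD) /=.
transitivity (p * (phi a * (phi a + phi b * phi r) +
      phi b * phi b * (rho * phi r - rho * rho))); last by ring.
by rewrite rho_sqr [rho * _]mulrC subrr mulr0 addr0.
Qed.


Local Notation quad := (quad_poly psi trho).

Lemma psi_trho a b :
  totq_inj (phi a + rho * phi b) = psi (totq_inj a) + trho * psi (totq_inj b).
Proof. by rewrite !psi_inj rmorphD rmorphM. Qed.

Lemma totq_quad_horner g h a b :
  (quad g h).[totq_inj (phi a + rho * phi b)] =
  psi g.[totq_inj a] +
  trho * psi ((totq_inj b *: Delta (totq_inj (b * r)) g).[totq_inj a]
              + h.[totq_inj (a + b * r)]).
Proof.
rewrite psi_trho (quad_poly_horner trho_sqr).
by rewrite -(rmorphM totq_inj b r) -(rmorphD totq_inj).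
Qed.

Lemma totq_Delta_quad (c d u : A) g h :
  totq_inj (phi c + rho * phi d) *:
    Delta (totq_inj ((phi c + rho * phi d) * phi u)) (quad g h) =
  quad
    (totq_inj c *: Delta (totq_inj (c * u)) g)
    (shift (totq_inj (c * u)) (totq_inj d *: Delta (totq_inj (d * r * u)) g)
     + totq_inj (c + d * r) *: Delta (totq_inj ((c + d * r) * u)) h).
Proof.
have := Delta_quad_poly trho_sqr (totq_inj c) (totq_inj d) (totq_inj u) g h.
rewrite -psi_trho psi_inj -!(rmorphM totq_inj) -!(rmorphD totq_inj).
by rewrite -!(rmorphM totq_inj).
Qed.

Lemma Int_quad g h :
  Int (quad g h) <->
  Int g /\ forall a b, exists c,
    (totq_inj b *: Delta (totq_inj (b * r)) g).[totq_inj a]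
      + h.[totq_inj (a + b * r)] = totq_inj c.
Proof.
split=> [hf|[hg hgh] x]; last first.
  have [a [b ->]] := quad_span x; rewrite totq_quad_horner.
  have [c ->] := hg a; have [d ->] := hgh a b.
  by exists (phi c + rho * phi d); rewrite psi_trho.
have key a b : exists c d, g.[totq_inj a] = totq_inj c /\
    (totq_inj b *: Delta (totq_inj (b * r)) g).[totq_inj a]
      + h.[totq_inj (a + b * r)] = totq_inj d.
  have [x] := hf (phi a + rho * phi b); rewrite totq_quad_horner.
  have [c [d ->]] := quad_span x; rewrite psi_trho => /eqP.
  rewrite -subr_eq0 opprD addrACA -mulrBr -!(rmorphB psi) => /eqP.
  case/totq_quad_free => /eqP; rewrite subr_eq0 => /eqP e1 /eqP.
  by rewrite subr_eq0 => /eqP e2; exists c, d.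
split=> [a|a b]; first by have [c [_ [e _]]] := key a 0; exists c.
by have [_ [d [_ e]]] := key a b; exists d.
Qed.

(** By induction on S.  In the step, the choices y = c (d = 0) and y = rho d (c = 0)
isolate the conditions on the individual polynomials. *)
Lemma IntS_quad S g h :
  IntS (mset_map phi S) (quad g h) <-> IntS (r +` S) g /\ IntS S h.
Proof.
elim/mset_ind_sub: S g h => [|s S IH] g h.
  rewrite mset_map0 !IntS_mset0 IntS_mset1 Int_quad.
  split=> [[hg hgh]|[[hg hgD] hh]]; last first.
    split=> // a b; have [c ->] := hgD b a; have [d ->] := hh (a + b * r).
    by exists (c + d); rewrite rmorphD.
  (* b = 0 in Int_quad gives the condition on h; subtracting it leaves that on g. *)
  have hh : Int h.
    move=> a; have [c] := hgh a 0.
    by rewrite mul0r addr0 rmorph0 scale0r horner0 add0r; exists c.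
  do 2![split=> //] => b a; have [c e] := hgh a b; have [d e'] := hh (a + b * r).
  by exists (c - d); rewrite rmorphB /= -e -e' addrK.
have sSS := msubset_refl S.
rewrite IntS_add_map (IH S sSS) (msetDCA (msetn 1 r)) !IntS_add.
split=> [[[hg hh] hT]|[[hg hgT] [hh hhT]]]; last first.
  split=> // T y sT; have [c [d ->]] := quad_span y.
  rewrite totq_Delta_quad; apply/(IH T sT); split.
    by have := hgT (r +` T) c (msetDS _ sT); rewrite msetBDl -mulrA.
  apply: IntSD; last by have := hhT T (c + d * r) sT; rewrite -mulrA.
  apply: IntS_shift; have := hgT T d (msubsetD1r r sT).
  by rewrite -(msetDBA (msetn 1 r) sT) prod_mset1D mulrACA mulrA.
(* d = 0, coefficient of rho *)
have hhT T y : T `<=` S ->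
    IntS T (totq_inj y *: Delta (totq_inj (y * s * \prod_(t <- S `\` T) t)) h).
  move=> sT; have := hT T (phi y + rho * phi 0) sT.
  rewrite totq_Delta_quad => /(IH T sT)[_].
  by rewrite rmorph0 scale0r /shift comp_poly0 add0r mul0r addr0 mulrA.
split; last by split; [exact: hh | exact: hhT].
split; first exact: hg.
move=> T y /msubset1DP[sT|[V -> sV]].
  (* c = 0: the coefficient of rho also contains a term in h, removed by hhT;
     the factor r of the index is the one contributed by S + r - T. *)
  have := hT T (phi 0 + rho * phi y) sT.
  rewrite totq_Delta_quad => /(IH T sT)[_].
  rewrite mul0r rmorph0 shift0 add0r => h1.
  have := IntSB h1 (hhT T (y * r) sT); rewrite -[_ * s * _]mulrA addrK.
  by rewrite -(msetDBA (msetn 1 r) sT) prod_mset1D mulrACA mulrA.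
(* d = 0, constant coefficient; here r belongs to the sub-multiset itself. *)
have := hT V (phi y + rho * phi 0) sV.
rewrite totq_Delta_quad => /(IH V sV)[+ _].
by rewrite msetBDl mulrA.
Qed.

End QuadraticExtension.

(** * Ring isomorphisms *)

Section Isomorphism.
Variables (A B : comNzRingType) (phi : {rmorphism A -> B}).
Hypothesis phi_inj : injective phi.
Hypothesis phi_surj : forall x, exists a, x = phi a.
Variable psi : {rmorphism totq A -> totq B}.
Hypothesis psi_inj : forall a, psi (totq_inj a) = totq_inj (phi a).

Lemma iso_totq_inj : injective psi.
Proof.
suff z u : psi u = 0 -> u = 0.
  by move=> u v e; apply/eqP; rewrite -subr_eq0; apply/eqP/z; rewrite rmorphB e subrr.
have [a [b [hb ->]]] := totqP u; have ub := totq_inj_unit hb.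
rewrite rmorph_div // => /(congr1 ( *%R^~ (psi (totq_inj b)))).
rewrite mul0r divrK ?rmorph_unit // psi_inj -(rmorph0 totq_inj).
by move=> /totq_inj_inj; rewrite -(rmorph0 phi) => /phi_inj ->; rewrite rmorph0 mul0r.
Qed.

Lemma iso_totq_surj x : exists u, x = psi u.
Proof.
have [p [q [hq ->]]] := totqP x; have [a ea] := phi_surj p; have [b eb] := phi_surj q.
have hb : GRing.lreg b.
  by move=> y z /= e; apply/phi_inj/hq; rewrite eb /= -!rmorphM e.
exists (totq_inj a / totq_inj b).
by rewrite rmorph_div ?totq_inj_unit // !psi_inj ea eb.
Qed.

(** Needed to start the tower: with no generator adjoined, the quotient ring is
isomorphic, but not equal, to R. *)
Lemma IntS_iso S g : IntS (mset_map phi S) (map_poly psi g) <-> IntS S g.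
Proof.
elim/mset_ind_sub: S g => [|s S IH] g.
  rewrite mset_map0 !IntS_mset0; split=> hg.
    move=> a; have [x] := hg (phi a); have [b ->] := phi_surj x.
    by rewrite -!psi_inj horner_map => /iso_totq_inj ->; exists b.
  move=> x; have [a ->] := phi_surj x; have [b e] := hg a.
  by exists (phi b); rewrite -!psi_inj horner_map e.
rewrite IntS_add_map IntS_add (IH S (msubset_refl S)).
have hT T y : T `<=` S ->
    IntS (mset_map phi T) (totq_inj (phi y) *: Delta
      (totq_inj (phi y * phi (s * \prod_(t <- S `\` T) t))) (map_poly psi g)) <->
    IntS T (totq_inj y *: Delta (totq_inj (y * s * \prod_(t <- S `\` T) t)) g).
  move=> sT; rewrite -(IH T sT) map_polyZ Delta_map !psi_inj.
  by rewrite -mulrA -(rmorphM phi y).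
split=> -[hg h]; (split; first exact: hg) => T y sT.
  by apply/(hT T y sT); apply: h.
by have [a ->] := phi_surj y; apply/(hT T a sT)/h.
Qed.

End Isomorphism.

(** * The tower of rings R[rho_1, ..., rho_n] *)

Import mpoly.
Local Open Scope quotient_scope.

(** The universal property of the quotient; it provides the inclusions of the
tower. *)
Lemma rho_ring_lift (R B : comNzRingType) n (r : 'I_n -> R)
    (f : {rmorphism R -> B}) (b : 'I_n -> B) :
  (forall i, b i * b i = f (r i) * b i) ->
  exists phi : {rmorphism rho_ring r -> B},
    (forall a, phi (rho_const r a) = f a) /\ (forall i, phi (rho r i) = b i).
Proof.
move=> b_sqr; pose F (x : rho_ring r) : B := mmap f b (repr x).
have F_pi p : F (\pi_(rho_ring r) p) = mmap f b p.
  apply/eqP; rewrite -subr_eq0 -rmorphB.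
  have : repr (\pi_(rho_ring r) p) - p \in rho_ideal r.
    by rewrite Quotient.idealrBE reprK.
  case/rho_idealP => q ->; rewrite rmorph_sum big1 //= => i _.
  rewrite rmorphM rmorphM rmorphB /= mmapX mmap1U mmapC.
  by rewrite mulrBr b_sqr [f _ * _]mulrC subrr mulr0.
have Fz : zmod_morphism F.
  by elim/quotW => p; elim/quotW => q; rewrite -rmorphB !F_pi rmorphB.
have Fm : monoid_morphism F.
  split; first by rewrite -(rmorph1 (\pi_(rho_ring r))) F_pi rmorph1.
  by elim/quotW => p; elim/quotW => q; rewrite -rmorphM !F_pi rmorphM.
pose phiz := GRing.isZmodMorphism.Build _ _ F Fz.
pose phim := GRing.isMonoidMorphism.Build _ _ F Fm.
pose phi : {rmorphism rho_ring r -> B} := HB.pack F phiz phim.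
exists phi; split=> [a|i]; rewrite /phi /= F_pi; first exact: mmapC.
by rewrite mmapX mmap1U.
Qed.

Lemma mset_map_comp (K L M : choiceType) (f : K -> L) (h : L -> M) (k : K -> M) S :
  (forall x, h (f x) = k x) -> mset_map h (mset_map f S) = mset_map k S.
Proof.
move=> e; apply/eq_seq_msetP; apply: perm_trans (perm_map h (perm_eq_seq_mset _)) _.
by rewrite -map_comp; apply/permPl; rewrite (eq_map e).
Qed.

(** Subsets of n + 1 indices come in two kinds, according to whether they contain
the index 0; both are indexed by the subsets of the remaining n indices. *)
Section OrdinalSets.
Variable n : nat.
Implicit Types (T : {set 'I_n.+1}) (U : {set 'I_n}).

Definition up0 U : {set 'I_n.+1} := lift ord0 @: U.
Definition up1 U : {set 'I_n.+1} := ord0 |: up0 U.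

Lemma ord0_up0 U : (ord0 \in up0 U) = false.
Proof. by apply/negbTE/negP => /imsetP[i _]. Qed.

Lemma lift_up0 U i : (lift ord0 i \in up0 U) = (i \in U).
Proof. exact/mem_imset/lift_inj. Qed.

Lemma ord0_up1 U : ord0 \in up1 U. Proof. exact: setU11. Qed.

Lemma lift_up1 U i : (lift ord0 i \in up1 U) = (i \in U).
Proof. by rewrite in_setU1 lift_up0. Qed.

Lemma up0_preim U : lift ord0 @^-1: up0 U = U.
Proof. by apply/setP => i; rewrite inE lift_up0. Qed.

Lemma up1_preim U : lift ord0 @^-1: up1 U = U.
Proof. by apply/setP => i; rewrite inE lift_up1. Qed.

Lemma preim_up0 T : ord0 \notin T -> up0 (lift ord0 @^-1: T) = T.
Proof.
move=> T0; apply/setP => i; case: (unliftP ord0 i) => [j|] ->.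
  by rewrite lift_up0 inE.
by rewrite ord0_up0 (negbTE T0).
Qed.

Lemma preim_up1 T : ord0 \in T -> up1 (lift ord0 @^-1: T) = T.
Proof.
move=> T0; apply/setP => i; case: (unliftP ord0 i) => [j|] ->.
  by rewrite lift_up1 inE.
by rewrite ord0_up1 T0.
Qed.

Lemma sum_setS (V : nmodType) (F : {set 'I_n.+1} -> V) :
  \sum_T F T = \sum_U F (up0 U) + \sum_U F (up1 U).
Proof.
rewrite (bigID (fun T => ord0 \in T)) [LHS]addrC /=; congr (_ + _).
  rewrite (reindex_onto up0 (fun T => lift ord0 @^-1: T)) /=; last exact: preim_up0.
  by apply: eq_bigl => U; rewrite ord0_up0 up0_preim eqxx.
rewrite (reindex_onto up1 (fun T => lift ord0 @^-1: T)) /=; last exact: preim_up1.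
by apply: eq_bigl => U; rewrite ord0_up1 up1_preim eqxx.
Qed.

Lemma all_setS (P : {set 'I_n.+1} -> Prop) :
  (forall T, P T) <-> (forall U, P (up0 U)) /\ (forall U, P (up1 U)).
Proof.
split=> [|[P0 P1] T]; first by [].
by have [/preim_up1 <-|/preim_up0 <-] := boolP (ord0 \in T).
Qed.

Definition set_case (X : Type) (g0 g1 : {set 'I_n} -> X) T : X :=
  (if ord0 \in T then g1 else g0) (lift ord0 @^-1: T).

Lemma set_case0 (X : Type) g0 g1 U : @set_case X g0 g1 (up0 U) = g0 U.
Proof. by rewrite /set_case ord0_up0 up0_preim. Qed.

Lemma set_case1 (X : Type) g0 g1 U : @set_case X g0 g1 (up1 U) = g1 U.
Proof. by rewrite /set_case ord0_up1 up1_preim. Qed.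

Lemma sub_familyE (K : choiceType) m (r : 'I_m -> K) (T : {set 'I_m}) x :
  sub_family r T x = (\sum_(i in T) (r i == x))%N.
Proof.
rewrite /sub_family mset_seqE count_map -big_enum -sum1_count [LHS]big_mkcond /=.
by apply: eq_bigr => i _; case: eqP.
Qed.

Lemma sub_familyC_up1 (K : choiceType) (r : 'I_n.+1 -> K) U :
  sub_family r (~: up1 U) = sub_family (r \o lift ord0) (~: U).
Proof.
apply/msetP => x; rewrite !sub_familyE big_mkcond big_ord_recl /=.
rewrite in_setC ord0_up1 add0n [RHS]big_mkcond; apply: eq_bigr => i _.
by rewrite !in_setC lift_up1.
Qed.

Lemma sub_familyC_up0 (K : choiceType) (r : 'I_n.+1 -> K) U :
  sub_family r (~: up0 U) = r ord0 +` sub_family (r \o lift ord0) (~: U).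
Proof.
apply/msetP => x; rewrite mset1DE !sub_familyE big_mkcond big_ord_recl /=.
rewrite in_setC ord0_up0 eq_sym [in RHS]big_mkcond; congr (_ + _)%N.
by apply: eq_bigr => i _; rewrite !in_setC lift_up0.
Qed.

End OrdinalSets.

(** R[rho_0, ..., rho_n] is a quadratic extension of R[rho_1, ..., rho_n],
generated by rho_0: sort the basis elements rho_T by whether 0 is in T. *)
Section Tower.
Variables (R : comNzRingType) (n : nat) (r : 'I_n.+1 -> R).
Let r' := r \o lift ord0.

Lemma rho_set_up1 U : rho_set r (up1 U) = rho r ord0 * rho_set r (up0 U).
Proof. by rewrite /rho_set big_setU1 // ord0_up0. Qed.

Variable phi : {rmorphism rho_ring r' -> rho_ring r}.
Hypothesis phi_const : forall a, phi (rho_const r' a) = rho_const r a.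
Hypothesis phi_rho : forall i, phi (rho r' i) = rho r (lift ord0 i).

Lemma phi_rho_set U : phi (rho_set r' U) = rho_set r (up0 U).
Proof.
rewrite /rho_set rmorph_prod big_imset /=; last by move=> i j _ _; apply: lift_inj.
by apply: eq_bigr => i _; rewrite phi_rho.
Qed.

Lemma phi_sum (a : {set 'I_n} -> R) :
  phi (\sum_U rho_const r' (a U) * rho_set r' U) =
  \sum_U rho_const r (a U) * rho_set r (up0 U).
Proof.
by rewrite rmorph_sum; apply: eq_bigr => U _; rewrite rmorphM phi_const phi_rho_set.
Qed.

Lemma rho_sumS (a : {set 'I_n.+1} -> R) :
  \sum_T rho_const r (a T) * rho_set r T =
  phi (\sum_U rho_const r' (a (up0 U)) * rho_set r' U) +
  rho r ord0 * phi (\sum_U rho_const r' (a (up1 U)) * rho_set r' U).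
Proof.
rewrite sum_setS !phi_sum mulr_sumr; congr (_ + _); apply: eq_bigr => U _.
by rewrite rho_set_up1 mulrCA.
Qed.

Lemma tower_span x : exists a b, x = phi a + rho r ord0 * phi b.
Proof. by have [a ->] := rho_spans x; rewrite rho_sumS; do 2!eexists. Qed.

Lemma tower_free x y : phi x + rho r ord0 * phi y = 0 -> x = 0 /\ y = 0.
Proof.
have [a ->] := rho_spans x; have [b ->] := rho_spans y.
pose c := set_case a b => e.
have /rho_free c0 : \sum_T rho_const r (c T) * rho_set r T = 0.
  rewrite rho_sumS -[RHS]e; congr (phi _ + _ * phi _); apply: eq_bigr => U _.
    by rewrite /c set_case0.
  by rewrite /c set_case1.
split; apply: big1 => U _.
  by rewrite -(set_case0 a b) -/c c0 rmorph0 mul0r.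
by rewrite -(set_case1 a b) -/c c0 rmorph0 mul0r.
Qed.

Lemma tower_reg a : GRing.lreg a -> GRing.lreg (phi a).
Proof.
move=> ha; apply: mulrI0_lreg => x; have [b [c ->]] := tower_span x.
rewrite mulrDr mulrCA -!(rmorphM phi) => /tower_free[/eqP + /eqP].
by rewrite !(mulrI_eq0 _ ha) => /eqP -> /eqP ->; rewrite rmorph0 mulr0 addr0.
Qed.

Variable psi : {rmorphism totq (rho_ring r') -> totq (rho_ring r)}.
Hypothesis psi_inj : forall a, psi (totq_inj a) = totq_inj (phi a).

Lemma psi_rho_totq u : psi (rho_totq r' u) = rho_totq r u.
Proof.
apply: (totq_rmorph_eq (f := psi \o rho_totq r')) => a /=.
rewrite /rho_totq !totq_map_inj; try exact: rho_const_reg.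
by rewrite psi_inj phi_const.
Qed.

Lemma rho_combS g :
  rho_comb r g =
  quad_poly psi (totq_inj (rho r ord0))
    (rho_comb r' (g \o @up0 n)) (rho_comb r' (g \o @up1 n)).
Proof.
rewrite /rho_comb sum_setS quad_poly_sum.
have term U (p : {poly totq R}) :
    map_poly psi (map_poly (rho_totq r') p * (totq_inj (rho_set r' U))%:P) =
    map_poly (rho_totq r) p * (totq_inj (rho_set r (up0 U)))%:P.
  rewrite (rmorphM (map_poly psi)) /= map_polyC /= psi_inj phi_rho_set.
  congr (_ * _); rewrite -map_poly_comp; apply: eq_map_poly => u /=.
  exact: psi_rho_totq.
congr (_ + _); apply: eq_bigr => U _ /=; rewrite term //.
rewrite rho_set_up1 rmorphM polyCM -mul_polyC.
by rewrite mulrCA.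
Qed.

End Tower.

(** The direct sum decomposition in a form suited to induction on n: the map
g |-> sum_T g_T rho_T is a bijection from families over T(R)[X] onto the
polynomials over T(R[rho]), and it matches the two membership conditions. *)
Definition rho_decomposition (R : comNzRingType) n (r : 'I_n -> R) : Prop :=
  [/\ forall g h, rho_comb r g = rho_comb r h -> forall T, g T = h T,
      forall f, exists g, f = rho_comb r g
    & forall S g, IntS (mset_map (rho_const r) S) (rho_comb r g) <->
                  forall T, IntS (S `+` sub_family r (~: T)) (g T)].

Lemma rho_decomposition0 (R : comNzRingType) (r : 'I_0 -> R) : rho_decomposition r.
Proof.
have sum0 (V : nmodType) (F : {set 'I_0} -> V) : \sum_T F T = F set0.
  rewrite (bigD1 set0) //= big1 ?addr0 // => T /eqP[].
  by apply/setP => -[].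
have set0E (T : {set 'I_0}) : T = set0 by apply/setP => -[].
have rho0 : rho_set r set0 = 1 by rewrite /rho_set big_set0.
have combE g : rho_comb r g = map_poly (rho_totq r) (g set0).
  by rewrite /rho_comb sum0 rho0 rmorph1 mulr1.
have c_inj : injective (rho_const r).
  move=> a b e; apply/eqP; rewrite -subr_eq0; apply/eqP.
  apply: (rho_free (r := r) (a := fun=> a - b) _ set0).
  by rewrite sum0 rho0 mulr1 rmorphB /= e subrr.
have c_surj x : exists a, x = rho_const r a.
  by have [a ->] := rho_spans x; exists (a set0); rewrite sum0 rho0 mulr1.
have t_inj a : rho_totq r (totq_inj a) = totq_inj (rho_const r a).
  by apply: totq_map_inj; apply: rho_const_reg.
split=> [g h|f|S g].
- rewrite !combE => e T; rewrite (set0E T).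
  exact: (map_inj_poly (iso_totq_inj c_inj t_inj) (rmorph0 _) e).
- elim/poly_ind: f => [|f u [g ->]].
    by exists (fun=> 0); rewrite combE rmorph0.
  have [v ->] := iso_totq_surj c_inj c_surj t_inj u.
  exists (fun=> g set0 * 'X + v%:P).
  rewrite !combE.
  rewrite (rmorphD (map_poly (rho_totq r))) (rmorphM (map_poly (rho_totq r))).
  by rewrite /= map_polyX map_polyC.
rewrite combE (IntS_iso c_inj c_surj t_inj).
have fam0 (T : {set 'I_0}) : S `+` sub_family r (~: T) = S.
  by rewrite /sub_family (set0E (~: T)) enum_set0 /= -enum_mset0 seq_mset_id msetD0.
by split=> [h T|/(_ set0)]; rewrite fam0 // (set0E T).
Qed.

(** The two coefficients over R[rho_1, ..., rho_n] lie in Int(-; S + r_0) and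
Int(-; S); the hypothesis decomposes each of them, and r_0 is then accounted for
by the complements of the sets T that do not contain 0. *)
Lemma rho_decompositionS (R : comNzRingType) n (r : 'I_n.+1 -> R) :
  rho_decomposition (r \o lift ord0) -> rho_decomposition r.
Proof.
set r' := r \o lift ord0 => -[comb_inj comb_span IntE].
have [phi [phi_const phi_rho]] := rho_ring_lift (r := r') (f := rho_const r)
  (b := fun i => rho r (lift ord0 i)) (fun i => rho_sqr r (lift ord0 i)).
have reg := tower_reg phi_const phi_rho.
have [psi psi_inj] := totq_extension reg.
have sqr : rho r ord0 * rho r ord0 = phi (rho_const r' (r ord0)) * rho r ord0.
  by rewrite phi_const rho_sqr.
have span := tower_span phi_const phi_rho.
have free := tower_free phi_const phi_rho.
have combS := rho_combS phi_const phi_rho psi_inj.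
have totq_free := totq_quad_free free psi_inj.
have totq_span := totq_quad_span sqr span free psi_inj.
split=> [g h|f|S g].
- rewrite !combS => /(quad_poly_inj totq_free)[/comb_inj e0 /comb_inj e1].
  by apply/all_setS; split=> U; [exact: e0 | exact: e1].
- have [p [q ->]] := quad_poly_span totq_span f.
  have [[g ->] [h ->]] := (comb_span p, comb_span q).
  exists (set_case g h); rewrite combS.
  have -> : rho_comb r' (set_case g h \o @up0 n) = rho_comb r' g.
    by apply: eq_bigr => U _; rewrite /= set_case0.
  have -> // : rho_comb r' (set_case g h \o @up1 n) = rho_comb r' h.
  by apply: eq_bigr => U _; rewrite /= set_case1.
rewrite -(mset_map_comp _ phi_const) combS.
rewrite (IntS_quad sqr span free psi_inj) -mset_map1D !IntE all_setS.
split=> -[h0 h1]; split=> U.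
- by have := h0 U; rewrite sub_familyC_up0 -msetDA msetDCA.
- by have := h1 U; rewrite sub_familyC_up1.
- by have := h0 U; rewrite sub_familyC_up0 -msetDA msetDCA.
by have := h1 U; rewrite sub_familyC_up1.
Qed.

Lemma rho_decomposition_holds (R : comNzRingType) n (r : 'I_n -> R) : rho_decomposition r.
Proof.
elim: n r => [|n IH] r; first exact: rho_decomposition0.
exact/rho_decompositionS/IH.
Qed.

Theorem theorem3p8 (R : comNzRingType) (n : nat) (r : 'I_n -> R) (S : {mset R}) :
  is_rho_dsum
    (IntS (mset_map (rho_const r) S))
    (fun T : {set 'I_n} => IntS (S `+` sub_family r (~: T)))
  /\
  is_rho_dsum
    (@Int (rho_ring r))
    (fun T : {set 'I_n} => IntS (sub_family r (~: T))).
Proof.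
have [comb_inj comb_span IntE] := rho_decomposition_holds r.
have dsum M N : (forall g, M (rho_comb r g) <-> forall T, N T (g T)) ->
    is_rho_dsum M N.
  move=> MN; split=> [f|g h _ _]; last exact: comb_inj.
  by split=> [|[g Ng ->]]; [have [g ->] := comb_span f => /MN; exists g | apply/MN].
split; apply: dsum => g; first exact: IntE.
have := IntE mset0 g; rewrite mset_map0 IntS_mset0 => ->.
by split=> h T; have := h T; rewrite mset0D.
Qed.
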